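(* Let $P\in\mathcal{B}(\mathcal{H})$ be an idempotent, written as $$P=\begin{pmatrix} I & P_1\\ 0&0\end{pmatrix}:R(P)\oplus R(P)^{\perp},\qquad P_1\in\mathcal{B}(R(P)^{\perp},R(P)).$$ If $J\in\mathcal{B}(\mathcal{H})$ is a symmetry with $JPJ=I-P$, then $\dim R(P)=\dim R(P)^{\perp}$ and, with respect to $\mathcal{H}=R(P)\oplus R(P)^{\perp}$, $$J=\begin{pmatrix} -U(I+P_1^{*}P_1)^{-\frac12}P_1^{*} & U(I+P_1^{*}P_1)^{-\frac12}\\ (I+P_1^{*}P_1)^{-\frac12}U^{*} & P_1^{*}U(I+P_1^{*}P_1)^{-\frac12}\end{pmatrix},$$ where $U$ is a unitary operator from $R(P)^{\perp}$ onto $R(P)$ with $U^{*}P_1=P_1^{*}U$.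
   Context: $\mathcal{H}$ is a separable complex Hilbert space; $\mathcal{B}(\mathcal{H},\mathcal{K})$ is the set of bounded linear operators from $\mathcal{H}$ to $\mathcal{K}$, and $\mathcal{B}(\mathcal{H})=\mathcal{B}(\mathcal{H},\mathcal{H})$. An idempotent is $P\in\mathcal{B}(\mathcal{H})$ with $P^2=P$ (not necessarily self-adjoint); its range $R(P)$ is closed, so $P$ always has the displayed $2\times2$ operator matrix form. A symmetry is an operator $J$ with $J=J^*=J^{-1}$. $\dim$ is the Hilbert space dimension. *)

(* Defs.v *)
From HB Require Import structures.
From mathcomp Require Import all_boot all_order all_algebra.
From mathcomp Require Import complex ring.
From mathcomp Require Import all_classical all_reals all_analysis.

Set Implicit Arguments.
Unset Strict Implicit.
Unset Printing Implicit Defensive.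

Import Order.TTheory GRing.Theory Num.Theory.
Import numFieldNormedType.Exports.

Local Open Scope classical_set_scope.
Local Open Scope ring_scope.
Local Open Scope complex_scope.

(* [inner] is linear in its first argument, conjugate-linear in its second. *)
HB.mixin Record NormedModule_isHilbert (R : realType) H
    & CompleteNormedModule R[i] H := {
  inner : {dot H for (@Num.conj R[i])} ;
  inner_norm : forall x : H, inner x x = `|x| ^+ 2
}.

#[short(type="hilbertType")]
HB.structure Definition Hilbert (R : realType) :=
  {H of CompleteNormedModule R[i] H & NormedModule_isHilbert R H}.

Definition separable (T : topologicalType) :=
  exists2 D : set T, countable D & dense D.

Section BoundedOperators.
Context {C : numFieldType} (H K : normedModType C).

Definition bounded_linear : {pred H -> K} := fun f =>
  `[< linear f /\ exists M : C, forall x, `|f x| <= M * `|x| >].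

Record bop := Bop { bop_fun :> H -> K ; bop_subproof : bop_fun \in bounded_linear }.

HB.instance Definition _ := [isSub for bop_fun].
HB.instance Definition _ := gen_eqMixin bop.
HB.instance Definition _ := gen_choiceMixin bop.

End BoundedOperators.

Notation "''B' ( H , K )" := (bop H K)
  (at level 8, format "''B' ( H ,  K )") : type_scope.
Section BopTheory.
Context {C : numFieldType}.
Implicit Types H K L : normedModType C.

Lemma bopP H K (T : 'B(H, K)) :
  linear T /\ exists M : C, forall x, `|T x| <= M * `|x|.
Proof. exact: (asboolW (bop_subproof T)). Qed.

Lemma bounded_linearP H K (f : H -> K) :
  linear f -> (exists M : C, forall x, `|f x| <= M * `|x|) ->
  f \in @bounded_linear C H K.
Proof. by move=> lf bf; apply: (@asboolT (_ /\ _)). Qed.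

HB.instance Definition _ H K (T : 'B(H, K)) :=
  @GRing.isLinear.Build C H K _ T (bopP T).1.

Lemma bop_bound H K (T : 'B(H, K)) :
  exists2 M : C, 0 <= M & forall x, `|T x| <= M * `|x|.
Proof.
have [_ [M HM]] := bopP T.
have [[x x0]|/forallNP H0] := pselect (exists x : H, x != 0).
  exists M => //; have := le_trans (normr_ge0 _) (HM x).
  by rewrite pmulr_lge0 // normr_gt0.
exists 0 => // x; have /negP := H0 x; rewrite negbK => /eqP ->.
by rewrite linear0 !normr0 mulr0.
Qed.

Lemma bounded_linear_submod_closed H K : submod_closed (@bounded_linear C H K).
Proof.
split.
  apply: bounded_linearP; first by move=> a x y; rewrite [RHS](_ : _ = a *: 0 + 0) // scaler0 addr0.
  by exists 0 => x; rewrite mul0r [X in `|X|](_ : _ = 0) // normr0.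
move=> a f g Hf Hg; pose F := Bop Hf; pose G := Bop Hg.
have [M M0 HM] := bop_bound F; have [N N0 HN] := bop_bound G.
apply: bounded_linearP.
  have [lf _] : linear f /\ True by split=> //; exact: (bopP F).1.
  have [lg _] : linear g /\ True by split=> //; exact: (bopP G).1.
  move=> b x y; rewrite !fctE lf lg.
  by rewrite !scalerDr addrACA !scalerA mulrC.
exists (`|a| * M + N) => x; rewrite !fctE (le_trans (ler_normD _ _)) //.
by rewrite mulrDl lerD ?HN // normrZ -mulrA ler_wpM2l // HM.
Qed.

HB.instance Definition _ H K :=
  @GRing.isSubmodClosed.Build C (H -> K) (@bounded_linear C H K)
    (bounded_linear_submod_closed H K).
HB.instance Definition _ H K := [SubChoice_isSubLmodule of bop H K by <:].

Lemma bop_continuous H K (T : 'B(H, K)) : continuous T.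
Proof.
have [M M0 HM] := bop_bound T.
apply/(@bounded_linear_continuous C H K T)/linear_boundedP.
near=> r => x; apply: le_trans (HM x) _; rewrite ler_wpM2r //.
near: r; apply: nbhs_pinfty_ge; exact: ger0_real.
Unshelve. all: by end_near. Qed.

Lemma bid_subproof H : (fun x : H => x) \in @bounded_linear C H H.
Proof. by apply: bounded_linearP => //; exists 1 => x; rewrite mul1r. Qed.
Definition bid H : 'B(H, H) := Bop (bid_subproof H).

Lemma bcomp_subproof H K L (S : 'B(K, L)) (T : 'B(H, K)) :
  (fun x => S (T x)) \in @bounded_linear C H L.
Proof.
have [M M0 HM] := bop_bound S; have [N N0 HN] := bop_bound T.
apply: bounded_linearP; first by move=> a x y; rewrite !linearP.
by exists (M * N) => x; rewrite (le_trans (HM _)) // -mulrA ler_wpM2l.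
Qed.
Definition bcomp H K L (S : 'B(K, L)) (T : 'B(H, K)) : 'B(H, L) :=
  Bop (bcomp_subproof S T).

End BopTheory.

Declare Scope bop_scope.
Delimit Scope bop_scope with B.
Notation "S \o T" := (bcomp S T) : bop_scope.
Notation "\1" := (bid _) : bop_scope.

Section ClosedSubspaces.
Context {C : numFieldType} (H : normedModType C).

Record csubspace := CSubspace {
  csub_set : set H ;
  csub0 : csub_set 0 ;
  csubP : forall (a : C) x y, csub_set x -> csub_set y -> csub_set (a *: x + y) ;
  csub_closed : closed csub_set
}.

Variable V : csubspace.

Definition csub_pred : {pred H} := fun x => x \in csub_set V.

Record csub := CSub { csub_val :> H ; csub_subproof : csub_val \in csub_pred }.

HB.instance Definition _ := [isSub for csub_val].
HB.instance Definition _ := [Choice of csub by <:].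

Lemma csub_submod_closed : submod_closed csub_pred.
Proof.
split; first exact/mem_set/csub0.
by move=> a x y /set_mem Vx /set_mem Vy; apply/mem_set/csubP.
Qed.

HB.instance Definition _ := @GRing.isSubmodClosed.Build C H
  csub_pred csub_submod_closed.
HB.instance Definition _ := [SubChoice_isSubLmodule of csub by <:].

Let csub_normD (x y : csub) : `|val (x + y)| <= `|val x| + `|val y|.
Proof. exact: ler_normD. Qed.

Let csub_normZ (a : C) (x : csub) : `|val (a *: x)| = `|a| * `|val x|.
Proof. exact: normrZ. Qed.

Let csub_norm0 (x : csub) : `|val x| = 0 -> x = 0.
Proof. by move=> /normr0_eq0 x0; apply: val_inj. Qed.

HB.instance Definition _ :=
  Lmodule_isNormed.Build C csub csub_normD csub_normZ csub_norm0.

Lemma csub_normE (x : csub) : `|x| = `|val x|.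
Proof. by []. Qed.

End ClosedSubspaces.

(* A closed subspace is itself a normed (below: Hilbert) space. *)
Coercion csub : csubspace >-> Sortclass.

Section CSubComplete.
Context {C : numFieldType} (H : completeNormedModType C) (V : csubspace H).

Lemma csub_complete (F : set_system V) : ProperFilter F -> cauchy F -> cvg F.
Proof.
move=> FF /cauchy_ballP FC.
pose G : set_system H := (csub_val (V := V)) @ F.
have /cauchy_cvg/cvg_ex[/= l Gl] : cauchy G.
  apply/cauchy_ballP => e e0; have := FC _ e0.
  move=> [[A B] /= [FA FB] AB].
  exists (csub_val (V := V) @` A, csub_val (V := V) @` B) => /=.
    by split; [apply: filterS FA|apply: filterS FB] => x /= ?; exists x.
  move=> [x y] /= [[a Aa <-] [b Bb <-]].
  have := AB (a, b) (conj Aa Bb).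
  by rewrite -!ball_normE /= csub_normE.
have Vl : csub_set V l.
  have := @closed_cvg V H F FF (@csub_val _ _ V) _ (@csub_closed _ _ V).
  apply; last exact: Gl.
  by apply: nearW => x; exact: set_mem (csub_subproof x).
apply/cvg_ex; exists (CSub (mem_set Vl)).
apply/cvgrPdist_lt => e e0.
by have /cvgrPdist_lt/(_ _ e0) := Gl.
Qed.

HB.instance Definition _ := Uniform_isComplete.Build (csub V) csub_complete.

End CSubComplete.

Section CSubHilbert.
Context {R : realType} (H : hilbertType R) (V : csubspace H).

Definition csub_inner (x y : V) : R[i] := inner (val x) (val y).

Let csub_inner_bilinear : bilinear_for *%R (Num.conj \; *%R) csub_inner.
Proof.
split=> [z a x y|z a x y].
  by rewrite /csub_inner /= linearPl.
by rewrite /csub_inner /= linearPr.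
Qed.

HB.instance Definition _ := bilinear_isBilinear.Build R[i] V V R[i]
  *%R (Num.conj \; *%R) csub_inner csub_inner_bilinear.

Let csub_inner_herm (x y : V) :
  csub_inner x y = (-1) ^+ false * Num.conj (csub_inner y x).
Proof. exact: hermC. Qed.

HB.instance Definition _ := isHermitianSesquilinear.Build R[i] V
  false Num.conj csub_inner csub_inner_herm.

Let csub_inner_gt0 (x : V) : x != 0 -> 0 < csub_inner x x.
Proof. by move=> x0; apply: neq0_dnorm_gt0. Qed.

HB.instance Definition _ := isDotProduct.Build R[i] V csub_inner csub_inner_gt0.

Let csub_inner_norm (x : V) : csub_inner x x = `|x| ^+ 2.
Proof. exact: inner_norm. Qed.

HB.instance Definition _ := NormedModule_isHilbert.Build R (csub V) csub_inner_norm.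

End CSubHilbert.

Lemma bop_ker_closed {C : numFieldType} (H K : normedModType C) (T : 'B(H, K)) :
  closed [set x | T x = 0].
Proof.
have -> : [set x | T x = 0] = T @^-1` [set 0] by [].
apply: preimage_closed => [x _|]; first exact: bop_continuous.
exact/accessible_closed_set1/hausdorff_accessible/norm_hausdorff.
Qed.

Section InnerTheory.
Context {R : realType} (H : hilbertType R).

Lemma cauchy_schwarz (x y : H) : `|inner x y| <= `|x| * `|y|.
Proof.
have [->|y0] := eqVneq y 0; first by rewrite linear0r !normr0 mulr0.
rewrite -ler_sqr ?nnegrE ?mulr_ge0 // exprMn -!inner_norm.
set a := inner x y; set n := inner y y.
have n0 : 0 < n by apply: neq0_dnorm_gt0.
have n_re : Num.conj n = n by apply: conj_Creal; exact: gtr0_real.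
have : 0 <= inner (n *: x - a *: y) (n *: x - a *: y).
  by rewrite inner_norm exprn_ge0.
have -> : inner (n *: x - a *: y) (n *: x - a *: y) =
    n * (inner x x * n - a * Num.conj a).
  have Z b c u v : inner (b *: u) (c *: v) = b * (Num.conj c * inner u v) :> R[i].
    by rewrite linearZl_LR linearZr_LR.
  rewrite (hnormB inner) /= !Z -/a -/n expr0 mul1r !rmorphM /= conjCK n_re.
  move: (inner x x) (Num.conj a) => s b; clear n_re Z; clearbody a n.
  by ring.
by rewrite pmulr_rge0 // subr_ge0 normCK.
Qed.

Lemma inner_bounded_linear (y : H) :
  (inner ^~ y) \in @bounded_linear R[i] H R[i]^o.
Proof.
apply: bounded_linearP; first by move=> a u v; rewrite linearPl.
by exists `|y| => x; rewrite mulrC cauchy_schwarz.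
Qed.

Variable V : csubspace H.

Definition orthoc_set : set H := [set x | forall y, csub_set V y -> inner x y = 0].

Lemma orthoc_closed : closed orthoc_set.
Proof.
have -> : orthoc_set = \bigcap_(y in csub_set V)
    [set x | Bop (inner_bounded_linear y) x = 0] by [].
by apply: closed_bigI => y _; apply: bop_ker_closed.
Qed.

Lemma orthoc0 : orthoc_set 0.
Proof. by move=> y _; rewrite linear0l. Qed.

Lemma orthocP (a : R[i]) x y :
  orthoc_set x -> orthoc_set y -> orthoc_set (a *: x + y).
Proof. by move=> ox oy z Vz; rewrite linearPl /= ox // oy // mulr0 addr0. Qed.

Definition orthoc : csubspace H := CSubspace orthoc0 orthocP orthoc_closed.

End InnerTheory.

Section Idempotents.
Context {C : numFieldType} (H : normedModType C) (P : 'B(H, H)).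
Hypothesis PP : (P \o P)%B = P.

Let PPx x : P (P x) = P x.
Proof. by rewrite -[in RHS]PP. Qed.

Lemma idem_range0 : range P 0.
Proof. by exists 0 => //; rewrite linear0. Qed.

Lemma idem_rangeP (a : C) x y : range P x -> range P y -> range P (a *: x + y).
Proof. by move=> [u _ <-] [v _ <-]; exists (a *: u + v); rewrite // linearP. Qed.

Lemma idem_range_closed : closed (range P).
Proof.
have -> : range P = [set x | (\1%B - P) x = 0]; last exact: bop_ker_closed.
apply/seteqP; split => [_ [x _ <-]|x /= /eqP].
  by apply/eqP; rewrite subr_eq0; apply/eqP/esym/PPx.
by rewrite subr_eq0 => /eqP xP; exists x.
Qed.

Definition idem_range : csubspace H :=
  CSubspace idem_range0 idem_rangeP idem_range_closed.

End Idempotents.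

Section HilbertOperators.
Context {R : realType}.
Implicit Types H K : hilbertType R.

Definition is_adjoint H K (T : 'B(H, K)) (S : 'B(K, H)) :=
  forall x y, inner (T x) y = inner x (S y).

(* Such an operator exists and is unique (Riesz), so the default is unused. *)
Definition adjoint H K (T : 'B(H, K)) : 'B(K, H) :=
  xget 0 [set S | is_adjoint T S].

Definition positive_op H (A : 'B(H, H)) := forall x, 0 <= inner (A x) x.

(* The positive square root: unique, and existing as soon as A is positive;
   0 for other A. *)
Definition sqrt_op H (A : 'B(H, H)) : 'B(H, H) :=
  xget 0 [set S | positive_op S /\ (S \o S)%B = A].

(* The bounded two-sided inverse; 0 when A is not invertible. *)
Definition inv_op H (A : 'B(H, H)) : 'B(H, H) :=
  xget 0 [set S | (S \o A)%B = \1%B /\ (A \o S)%B = \1%B].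

Definition inv_sqrt_op H (A : 'B(H, H)) : 'B(H, H) := inv_op (sqrt_op A).

Definition unitary_op H K (U : 'B(H, K)) :=
  (adjoint U \o U)%B = \1%B /\ (U \o adjoint U)%B = \1%B.

Definition symmetry H (J : 'B(H, H)) :=
  adjoint J = J /\ (J \o J)%B = \1%B.

(* T = [A B; C D] with respect to the decomposition V (+) V^_|_ of H. *)
Definition block_form H (V : csubspace H) (T : 'B(H, H)) (A : 'B(V, V))
    (B : 'B(orthoc V, V)) (C : 'B(V, orthoc V)) (D : 'B(orthoc V, orthoc V)) :=
  forall (x : V) (y : orthoc V),
    T (val x + val y) = val (A x + B y) + val (C x + D y).

Definition hilbert_basis H (E : set H) :=
  (forall x y, E x -> E y -> inner x y = (x == y)%:R) /\
  (forall x, (forall e, E e -> inner x e = 0) -> x = 0).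

(* The Hilbert dimension is the cardinality of a Hilbert basis; bases exist and
   all have the same cardinality, so comparing one basis of each is enough. *)
Definition same_hdim H K := exists (E : set H) (F : set K),
  [/\ hilbert_basis E, hilbert_basis F & (E #= F)%card].

End HilbertOperators.

Notation "T ^*" := (adjoint T) : bop_scope.

(* Main.v *)
Require Import Defs.
From mathcomp Require Import all_boot all_order all_algebra.
From mathcomp Require Import complex ring.
From mathcomp Require Import all_classical all_reals all_analysis.

Set Implicit Arguments.
Unset Strict Implicit.
Unset Printing Implicit Defensive.

Import Order.TTheory GRing.Theory Num.Theory.
Import numFieldNormedType.Exports.
Local Open Scope ring_scope.

(** Split [H] as [V (+) W] with [V] the range of [P] and [W] its orthogonal
    complement, and write [J] as [A B; B^* D] with [A] and [D] self-adjoint.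
    Since [J] is an involution, [J P J = 1 - P] says [J P + P J = J]; reading
    this entrywise gives [A = - P1 B^*], [D = B^* P1] and [A P1 = - P1 D], and
    taking adjoints gives [A = - B P1^*] and [D = P1^* B].  Put
    [T = 1 + P1^* P1].  The four entries of [J^2 = 1] then become
    [B T B^* = 1] and [T B^* B = B^* B T = 1], so [B] is invertible and its
    polar factor is found explicitly: [U = B T^(1/2)] is unitary.  Hence
    [B = U S], [B^* = S U^*] with [S = T^(-1/2)], and the formulas for [A] and
    [D] become the announced ones.

    The relation [U^* P1 = P1^* U] reads [T^(1/2) D = D T^(1/2)].  As
    [A P1 = - P1 D], the operator [D] commutes with [P1^* P1] and so with [T];
    what remains is that a square root commutes with everything that commutes
    with [T].  This is why the square root is built by hand, as a limit of
    polynomials in [T] ([sqrt_exists]), and shown to be the only positive one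
    ([sqrt_op_spec]).  [unitary_factor] carries out this computation for
    abstract operators, [symmetry_block_form] extracts the blocks of [J].

    Two general facts support this: adjoints exist ([adjoint_exists], from the
    Riesz theorem [riesz]), and with them the decomposition of [H], because the
    adjoint of the inclusion of a closed subspace is the orthogonal projection
    onto it ([orthoc_decomposition]).  Finally the unitary [U] carries a Hilbert
    basis of [W] to one of [V], so that the dimensions agree
    ([unitary_same_hdim]). *)

(** * Real numbers and geometric rates of convergence *)

Section GeometricRates.
Context {R : realType}.
Implicit Types (c q : R[i]).

Lemma nonneg_real (x : R[i]) : 0 <= x -> exists2 r : R, 0 <= r & x = r%:C%C.
Proof.
move=> x0; have xr := ger0_real x0.
exists (complex.Re x); last by rewrite RRe_real.
by rewrite -ler0c (RRe_real xr).
Qed.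

(** A positive complex number is real, and so are [c] and [q] here: the claim is
    the convergence to zero of a real geometric sequence. *)
Lemma geometric_lt c q (e : R[i]) : 0 <= c -> 0 <= q < 1 -> 0 < e ->
  exists N, forall n, (N <= n)%N -> c * q ^+ n < e.
Proof.
move=> c0 /andP[q0 q1] e0.
have [r r0 qE] := nonneg_real q0.
have [d d0' eE] := nonneg_real (ltW e0).
have [k k0 cE] := nonneg_real c0.
subst q e c.
have d0 : 0 < d by rewrite -ltcR.
have r1 : `|r| < 1 by rewrite ger0_norm // -ltcR.
have dk : 0 < d / (k + 1) by rewrite divr_gt0 // ltr_wpDl.
have /cvgrPdist_lt/(_ _ dk)[N _ HN] := cvg_expr r1.
exists N => n Nn; have := HN n Nn.
rewrite /= sub0r normrN normrX ger0_norm // ltr_pdivlMr ?ltr_wpDl // => h.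
rewrite -rmorphXn -rmorphM ltcR; apply: le_lt_trans h.
by rewrite mulrC ler_wpM2l ?exprn_ge0 // lerDl.
Qed.

(** The way limits are used below: a quantity bounded by a geometric error of
    every order vanishes, or is nonpositive.  The bound forces [a] to be real,
    without which [a <= 0] would not be the negation of [0 < a]. *)
Lemma le_geometric_le0 c q (a : R[i]) : 0 <= c -> 0 <= q < 1 ->
  (forall n, a <= c * q ^+ n) -> a <= 0.
Proof.
move=> c0 q01 H.
have ar : a \is Num.real.
  by rewrite (ler_real (H 0%N)) ger0_real // mulr_ge0 // exprn_ge0 //.
rewrite real_leNgt ?real0 //; apply/negP => a0.
have [N /(_ N (leqnn _)) HN] := geometric_lt c0 q01 a0.
by have := le_lt_trans (H N) HN; rewrite ltxx.
Qed.

Lemma geometric_eq (K : normedModType R[i]) (u v : K) c q :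
  0 <= c -> 0 <= q < 1 -> (forall n, `|u - v| <= c * q ^+ n) -> u = v.
Proof.
move=> c0 q01 H; apply/eqP; rewrite -subr_eq0 -normr_le0.
exact: le_geometric_le0 H.
Qed.

(** The limit inherits the rate of the Cauchy condition, so that no filter is
    needed once the limit has been chosen. *)
Lemma geometric_cauchy_limit (K : completeNormedModType R[i]) (u : nat -> K) c q :
  0 <= c -> 0 <= q < 1 ->
  (forall n k, `|u (n + k)%N - u n| <= c * q ^+ n) ->
  exists l, forall n, `|l - u n| <= c * q ^+ n.
Proof.
move=> c0 q01 H.
have /cauchy_cvg/cvg_ex[l ul] : cauchy (u x @[x --> \oo])%classic.
  apply: cauchy_exP => e e0.
  have [N HN] := geometric_lt c0 q01 e0.
  exists (u N), N => // n /= Nn; rewrite -ball_normE /= distrC.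
  by rewrite -(subnKC Nn); apply: le_lt_trans (H _ _) (HN _ _).
exists l => n; rewrite -subr_le0.
(* Comparing [l] with a far term costs an arbitrarily small error, here a
   power of 1/2. *)
apply: (@le_geometric_le0 1 2^-1) => //.
  by rewrite invr_ge0 ler0n invf_lt1 ?ltr1n ?ltr0n.
move=> m; rewrite mul1r.
have m0 : 0 < (2^-1 : R[i]) ^+ m by rewrite exprn_gt0 // invr_gt0 ltr0n.
have /cvgrPdist_lt/(_ _ m0)[N _ HN] := ul.
have /= := HN (n + N)%N; rewrite /= leq_addl => /(_ isT) /ltW h.
rewrite lerBlDr (le_trans (ler_distD (u (n + N)%N) _ _)) //.
by rewrite lerD.
Qed.

End GeometricRates.

(** * Inner products and bounded operators *)

Section InnerProduct.
Context {R : realType} (H : hilbertType R).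
Implicit Types (x y z : H) (a : R[i]).

Lemma innerC x y : inner x y = Num.conj (inner y x).
Proof. by rewrite hermC expr0 mul1r. Qed.

Lemma innerDl x y z : inner (x + y) z = inner x z + inner y z.
Proof. exact: linearDl. Qed.

Lemma innerDr x y z : inner z (x + y) = inner z x + inner z y.
Proof. exact: linearDr. Qed.

Lemma innerNl x y : inner (- x) y = - inner x y.
Proof. exact: linearNl. Qed.

Lemma innerNr x y : inner x (- y) = - inner x y.
Proof. exact: linearNr. Qed.

Lemma innerBl x y z : inner (x - y) z = inner x z - inner y z.
Proof. exact: linearBl. Qed.

Lemma innerBr x y z : inner z (x - y) = inner z x - inner z y.
Proof. exact: linearBr. Qed.

Lemma innerZl a x y : inner (a *: x) y = a * inner x y.
Proof. exact: linearZl_LR. Qed.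

Lemma innerZr a x y : inner x (a *: y) = Num.conj a * inner x y.
Proof. exact: linearZr_LR. Qed.

Lemma inner_inj x y : (forall z, inner z x = inner z y) -> x = y.
Proof.
move=> h; apply/eqP; rewrite -subr_eq0 -normr_eq0 -sqrf_eq0 -inner_norm.
by rewrite innerBr h subrr.
Qed.

End InnerProduct.

Section BoundedOperatorTheory.
Context {C : numFieldType}.
Implicit Types A B L : normedModType C.

Lemma bop_ext A B (S T : 'B(A, B)) : (forall x, S x = T x) -> S = T.
Proof. by move=> ST; apply/val_inj/funext. Qed.

Lemma bop_congr A B (S T : 'B(A, B)) x : S = T -> S x = T x.
Proof. by move->. Qed.

Lemma bop0 A B (T : 'B(A, B)) : T 0 = 0.
Proof. exact: linear0. Qed.

Lemma bopD A B (T : 'B(A, B)) x y : T (x + y) = T x + T y.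
Proof. exact: linearD. Qed.

Lemma bopN A B (T : 'B(A, B)) x : T (- x) = - T x.
Proof. exact: linearN. Qed.

Lemma bcompE A B L (S : 'B(B, L)) (T : 'B(A, B)) x : bcomp S T x = S (T x).
Proof. by []. Qed.

End BoundedOperatorTheory.

(** * The Riesz representation theorem and adjoints *)

Section Riesz.
Context {R : realType} (H : hilbertType R).
Variables (f : H -> R[i]) (M : R[i]).
Hypotheses (lf : forall a x y, f (a *: x + y) = a * f x + f y).
Hypothesis M0 : 0 <= M.
Hypothesis bf : forall x, `|f x| <= M * `|x|.

(** The representing vector minimises [|x|^2 - 2 Re (f x)].  Almost minimisers
    suffice: if [phi x] exceeds the infimum by at most [d], then perturbing [x]
    along [z] shows that [inner z x] differs from [f z] by at most
    [sqrt d * |z|].  Such an estimate, uniform in [z], makes a minimising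
    sequence Cauchy and identifies the functional of its limit. *)
Let phi x : R[i] := inner x x - (f x + Num.conj (f x)).

Let phi_real x : phi x \is Num.real.
Proof.
rewrite rpredB //; first by rewrite ger0_real // dnorm_ge0.
by apply/CrealP; rewrite rmorphD /= conjCK addrC.
Qed.

Let phi_bound x : - (M ^+ 2) <= phi x.
Proof.
have h : f x + (f x)^* <= 2 * (M * `|x|).
  apply: le_trans (_ : `|f x + (f x)^*| <= _).
    by rewrite real_ler_norm //; apply/CrealP; rewrite rmorphD /= conjCK addrC.
  rewrite (le_trans (ler_normD _ _)) // norm_conjC.
  by rewrite mulr_natl mulr2n lerD.
have -> : phi x = (`|x| - M) ^+ 2 - M ^+ 2 + (2 * (M * `|x|) - (f x + (f x)^*)).
  by rewrite /phi inner_norm; ring.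
rewrite addrAC -subr_ge0 opprK subrK addr_ge0 ?subr_ge0 //.
by rewrite real_exprn_even_ge0 // rpredB ?ger0_real.
Qed.

(** Infima exist in [R] only, hence the passage through real parts. *)
Let E : set R := range (fun x => complex.Re (phi x)).

Let phiE x : phi x = (complex.Re (phi x))%:C%C.
Proof. by rewrite RRe_real. Qed.

Let Einf : has_inf E.
Proof.
split; first by exists (complex.Re (phi 0)), 0.
have [k k0 kE] := nonneg_real M0.
exists (- k ^+ 2) => _ [x _ <-].
by rewrite -lecR -phiE rmorphN rmorphXn /= -kE.
Qed.

Let m : R[i] := (inf E)%:C%C.

Let m_le x : m <= phi x.
Proof. by rewrite phiE lecR ge_inf //; [case: Einf|exists x]. Qed.

Let m_adherent (d : R[i]) : 0 < d -> exists x, phi x <= m + d.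
Proof.
move=> d0; have [k k0' dE] := nonneg_real (ltW d0); rewrite dE in d0 *.
have k0 : 0 < k by rewrite -ltcR.
have [_ [x _ <-] h] := inf_adherent k0 Einf.
by exists x; rewrite phiE -rmorphD lecR ltW.
Qed.

Let phi_perturb x (d : R[i]) z : phi x <= m + d ->
  `|inner z x - f z| ^+ 2 <= d * `|z| ^+ 2.
Proof.
set g := inner z x - f z => h.
have [z0|z0] := eqVneq z 0.
  rewrite /g z0 linear0l normr0 expr0n mulr0.
  have := lf 1 0 0; rewrite scale1r addr0 mul1r => /eqP.
  by rewrite -subr_eq0 opprD addNKr oppr_eq0 => /eqP ->; rewrite subr0 normr0 expr0n.
have n0 : 0 < `|z| ^+ 2 by rewrite exprn_gt0 // normr_gt0.
(* The optimal step along [z]: it minimises [phi (x + t *: z)]. *)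
pose t := - (g^* / `|z| ^+ 2).
have := m_le (x + t *: z).
have -> : phi (x + t *: z) = phi x - `|g| ^+ 2 / `|z| ^+ 2.
  have tE : t^* = - (g / `|z| ^+ 2).
    by rewrite rmorphN rmorphM /= conjCK (@conj_Creal _ (_^-1)) // ger0_real // invr_ge0 ltW.
  have wE : inner z x = g + f z by rewrite subrK.
  rewrite /phi linearDl /= !linearDr /= !innerZl !innerZr (innerC x z) wE.
  rewrite (addrC x) lf (normCKC g) (rmorphD _ g) (rmorphD _ (t * f z)).
  rewrite rmorphM /= !inner_norm tE /t.
  move: n0; move: (`|z| ^+ 2) (g^* ) (f z) (f z)^* (f x) (f x)^* (inner x x).
  move=> N gs a b c d' e N0.
  have : N != 0 by rewrite gt_eqF.
  by move=> ?; field.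
move=> h2; have := le_trans h2 (lerB h (lexx _)).
by rewrite -addrA lerDl subr_ge0 ler_pdivrMr.
Qed.

Lemma riesz : exists y, forall z, f z = inner z y.
Proof.
pose d n : R[i] := (2^-1) ^+ n.
have d0 n : 0 < d n by rewrite exprn_gt0 // invr_gt0 ltr0n.
have q01 : 0 <= (2^-1 : R[i]) < 1.
  by rewrite invr_ge0 ler0n invf_lt1 ?ltr1n ?ltr0n.
have /choice[u phi_u] : forall n, exists x, phi x <= m + d n ^+ 2.
  by move=> n; apply: m_adherent; rewrite exprn_gt0.
have u_near n z : `|inner z (u n) - f z| <= d n * `|z|.
  rewrite -ler_sqr ?nnegrE ?mulr_ge0 ?(ltW (d0 n)) // exprMn.
  exact: phi_perturb.
have u_cauchy n k : `|u (n + k)%N - u n| <= 2 * d n.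
  (* Testing both estimates against the difference itself bounds its norm. *)
  set w := u _ - u _.
  have [->|w0] := eqVneq w 0; first by rewrite normr0 mulr_ge0 // ltW.
  have : `|inner w w| <= 2 * d n * `|w|.
    rewrite {2}/w linearBr /=.
    have -> : inner w (u (n + k)%N) - inner w (u n) =
      (inner w (u (n + k)%N) - f w) - (inner w (u n) - f w).
      by rewrite opprB addrA subrK.
    rewrite (le_trans (ler_normB _ _)) // mulrDl mulrDl !mul1r lerD //.
    apply: le_trans (u_near _ _) _; rewrite ler_wpM2r //.
    rewrite /d exprD ler_piMr ?(ltW (d0 n)) // exprn_ile1 //.
    by case/andP: q01 => _ /ltW.
  by rewrite inner_norm normrX normr_id expr2 ler_pM2r // normr_gt0.
have [y Hy] := geometric_cauchy_limit (ler0n _ 2) q01 u_cauchy.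
exists y => z; apply/eqP; rewrite eq_sym -subr_eq0 -normr_le0.
apply: (@le_geometric_le0 _ (3 * `|z|) 2^-1) => //.
move=> n; rewrite -(subrK (inner z (u n)) (inner z y)) -addrA.
rewrite (le_trans (ler_normD _ _)) //.
have -> : 3 * `|z| * 2^-1 ^+ n = `|z| * (2 * d n) + d n * `|z|.
  by rewrite /d; ring.
rewrite lerD // -linearBr /= (le_trans (cauchy_schwarz _ _)) //.
by rewrite ler_wpM2l.
Qed.

End Riesz.

Local Open Scope bop_scope.

Section Adjoint.
Context {R : realType}.
Implicit Types H K L : hilbertType R.

(** Riesz applied to [x |-> inner (T x) y] for each [y]; boundedness follows by
    testing [S y] against itself. *)
Lemma adjoint_exists H K (T : 'B(H, K)) : exists S, is_adjoint T S.
Proof.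
have [M M0 HM] := bop_bound T.
have rz y : exists z, forall x, inner (T x) y = inner x z.
  apply: (@riesz R H (fun x => inner (T x) y) (M * `|y|)).
  - by move=> a u v; rewrite !linearP /= linearPl.
  - by rewrite mulr_ge0.
  - move=> x; rewrite (le_trans (cauchy_schwarz _ _)) // mulrAC.
    by rewrite ler_wpM2r.
have [S HS] := choice rz.
have bS : S \in @bounded_linear _ K H.
  apply: bounded_linearP.
    move=> a u v; apply: inner_inj => z.
    by rewrite linearPr /= -!HS linearPr.
  exists M => y; have [->|Sy0] := eqVneq (S y) 0.
    by rewrite normr0 mulr_ge0.
  have : `|inner (S y) (S y)| <= M * `|y| * `|S y|.
    rewrite -HS (le_trans (cauchy_schwarz _ _)) // mulrAC.
    by rewrite ler_wpM2r.
  by rewrite inner_norm normrX normr_id expr2 ler_pM2r // normr_gt0.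
by exists (Bop bS) => x y; rewrite HS.
Qed.

Lemma adjP H K (T : 'B(H, K)) x y : inner (T x) y = inner x (T^* y).
Proof. by have := xgetPex 0 (adjoint_exists T); apply. Qed.

Lemma adjP' H K (T : 'B(H, K)) x y : inner (T^* x) y = inner x (T y).
Proof. by rewrite innerC -adjP -innerC. Qed.

Lemma adjoint_unique H K (T : 'B(H, K)) S : is_adjoint T S -> T^* = S.
Proof. by move=> h; apply: bop_ext => y; apply: inner_inj => z; rewrite -adjP h. Qed.

Lemma adjM H K L (S : 'B(K, L)) (T : 'B(H, K)) : (S \o T)^* = T^* \o S^*.
Proof. by apply: adjoint_unique => x y /=; rewrite !adjP. Qed.

End Adjoint.

(** * Square roots of operators *)

Section OperatorLimit.
Context {R : realType}.

(** A form of completeness of the space of operators; pointwise limits with a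
    rate proportional to [|x|] are automatically linear and bounded. *)
Lemma bop_geometric_limit (H : normedModType R[i])
    (K : completeNormedModType R[i]) (Y : nat -> 'B(H, K)) (q : R[i]) :
  0 <= q < 1 ->
  (forall n k x, `|Y (n + k)%N x - Y n x| <= `|x| * q ^+ n) ->
  exists Z : 'B(H, K), forall n x, `|Z x - Y n x| <= `|x| * q ^+ n.
Proof.
move=> q01 HY.
have /choice[Z HZ] : forall x, exists l, forall n, `|l - Y n x| <= `|x| * q ^+ n.
  move=> x; apply: (geometric_cauchy_limit (normr_ge0 x) q01) => n k.
  exact: HY.
have bZ : Z \in @bounded_linear _ H K.
  apply: bounded_linearP.
    move=> a x y.
    apply: (@geometric_eq _ _ _ _ (`|a *: x + y| + `|a| * `|x| + `|y|) q) => //.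
    move=> n.
    have -> : Z (a *: x + y) - (a *: Z x + Z y) =
      (Z (a *: x + y) - Y n (a *: x + y)) - a *: (Z x - Y n x) - (Z y - Y n y).
      rewrite (linearP (Y n)) /= scalerBr !opprB !opprD !addrA.
      rewrite [RHS](ACl (1*5*7*2*4*3*6)%AC) /=.
      by rewrite !subrK.
    rewrite !mulrDl.
    rewrite (le_trans (ler_normB _ _)) // lerD // (le_trans (ler_normB _ _)) //.
    by rewrite lerD // normrZ -mulrA ler_wpM2l.
  have [M M0 HM] := bop_bound (Y 0%N).
  exists (1 + M) => x; rewrite -(subrK (Y 0%N x) (Z x)) mulrDl mul1r.
  rewrite (le_trans (ler_normD _ _)) // lerD //.
  by have := HZ x 0%N; rewrite expr0 mulr1.
by exists (Bop bZ).
Qed.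

(** The geometric estimate is all that survives of the sequence in the limit:
    identities satisfied by every term hold for the limit up to an error of
    order [q ^+ n], hence exactly. *)
Section LimitProperties.
Context (H : hilbertType R) (Y : nat -> 'B(H, H)) (Z : 'B(H, H)) (q : R[i]).
Hypotheses (q01 : 0 <= q < 1)
  (YZ : forall n x, `|Z x - Y n x| <= `|x| * q ^+ n).

Lemma limit_self_adjoint : (forall n, is_adjoint (Y n) (Y n)) -> is_adjoint Z Z.
Proof.
move=> Ysa x y.
apply: (@geometric_eq _ R[i]^o _ _ (2 * (`|x| * `|y|)) q) => // n.
have -> : inner (Z x) y - inner x (Z y) =
    inner (Z x - Y n x) y - inner x (Z y - Y n y).
  by rewrite innerBl innerBr Ysa opprB addrA subrK.
have -> : 2 * (`|x| * `|y|) * q ^+ n =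
   `|x| * q ^+ n * `|y| + `|x| * (`|y| * q ^+ n) by ring.
rewrite (le_trans (ler_normB _ _)) // lerD //.
  by rewrite (le_trans (cauchy_schwarz _ _)) // ler_wpM2r.
by rewrite (le_trans (cauchy_schwarz _ _)) // ler_wpM2l.
Qed.

Lemma limit_commute (D : 'B(H, H)) :
  (forall n x, D (Y n x) = Y n (D x)) -> forall x, D (Z x) = Z (D x).
Proof.
move=> DY x; have [N N0 HN] := bop_bound D.
apply: (@geometric_eq _ _ _ _ (N * `|x| + `|D x|) q) => //.
  by rewrite addr_ge0 // mulr_ge0.
move=> n.
have -> : D (Z x) - Z (D x) = D (Z x - Y n x) - (Z (D x) - Y n (D x)).
  by rewrite bopD bopN DY opprB addrA subrK.
rewrite mulrDl (le_trans (ler_normB _ _)) // lerD //.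
by rewrite (le_trans (HN _)) // -mulrA ler_wpM2l.
Qed.

End LimitProperties.

End OperatorLimit.

Section QuadraticFixpoint.
Context {R : realType} (H : completeNormedModType R[i]).
Variable E : 'B(H, H).

(** If [(1 - Z)^2 = 1 - E] then [Z = (Z^2 + E) / 2].  On the operators bounded
    by [q < 1] the right-hand side is a contraction of ratio [q], so its
    iterates from [0], which are polynomials in [E], converge to such a [Z]. *)
Definition quadratic_iter (n : nat) : 'B(H, H) :=
  iter n (fun Z : 'B(H, H) => (2^-1 : R[i]) *: ((Z \o Z) + E)) 0.

Lemma quadratic_iterS n x : quadratic_iter n.+1 x =
  (2^-1 : R[i]) *: (quadratic_iter n (quadratic_iter n x) + E x).
Proof. by []. Qed.

Variable q : R[i].
Hypotheses (q01 : 0 <= q < 1) (Eq : forall x, `|E x| <= q * `|x|).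

Let q0 : 0 <= q. Proof. by case/andP: q01. Qed.

Local Notation Y := quadratic_iter.

Let half_ge0 : 0 <= (2^-1 : R[i]). Proof. by rewrite invr_ge0. Qed.

Let Ybound n x : `|Y n x| <= q * `|x|.
Proof.
elim: n x => [|n IH] x; first by rewrite normr0 mulr_ge0.
rewrite quadratic_iterS normrZ ger0_norm //.
have -> : q * `|x| = 2^-1 * (q * `|x| + q * `|x|) by field.
rewrite ler_wpM2l // (le_trans (ler_normD _ _)) // lerD //.
apply: le_trans (IH _) _; rewrite ler_wpM2l //.
apply: le_trans (IH _) _; rewrite ler_piMl //.
by case/andP: q01 => _ /ltW.
Qed.

(** Each step contracts the distance between two trajectories, so comparing the
    trajectory with its own shift yields the Cauchy estimate directly, with no
    geometric series to sum. *)
Let Ycauchy n k x : `|Y (n + k)%N x - Y n x| <= `|x| * q ^+ n.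
Proof.
elim: n x => [|n IH] x.
  rewrite add0n subr0 expr0 mulr1 (le_trans (Ybound _ _)) // ler_piMl //.
  by case/andP: q01 => _ /ltW.
rewrite addSn !quadratic_iterS -scalerBr normrZ ger0_norm // opprD addrACA subrr addr0.
have -> : `|x| * q ^+ n.+1 = 2^-1 * (`|x| * q ^+ n.+1 + `|x| * q ^+ n.+1) by field.
rewrite ler_wpM2l //.
rewrite -(subrK (Y (n + k)%N (Y n x)) (Y (n + k)%N (Y (n + k)%N x))) -addrA.
rewrite (le_trans (ler_normD _ _)) // lerD //.
  rewrite -linearB (le_trans (Ybound _ _)) // exprS mulrCA ler_wpM2l //.
apply: le_trans (IH _) _.
by rewrite exprS mulrA ler_wpM2r ?exprn_ge0 // [leRHS]mulrC.
Qed.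

Lemma quadratic_fixpoint : exists Z : 'B(H, H),
  [/\ forall x, `|Z x| <= q * `|x|,
      forall x, 2 *: Z x = Z (Z x) + E x &
      forall n x, `|Z x - Y n x| <= `|x| * q ^+ n].
Proof.
have [Z HZ] := bop_geometric_limit q01 Ycauchy.
have Zb x : `|Z x| <= q * `|x|.
  rewrite -subr_le0; apply: (@le_geometric_le0 _ `|x| q) => // n.
  rewrite lerBlDr -(subrK (Y n x) (Z x)) (le_trans (ler_normD _ _)) //.
  by rewrite lerD ?HZ ?Ybound.
exists Z; split => //.
move=> x; apply: (@geometric_eq _ _ _ _ (4 * `|x|) q) => //.
move=> n.
have -> : 2 *: Z x - (Z (Z x) + E x) =
    2 *: (Z x - Y n.+1 x) - (Z (Z x - Y n x)) - (Z (Y n x) - Y n (Y n x)).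
  rewrite scalerBr linearB quadratic_iterS scalerA mulfV ?pnatr_eq0 // scale1r.
  rewrite !opprB !opprD !addrA.
  by rewrite [RHS](ACl (1*5*3*2*6*7*4)%AC) /= !subrK.
have -> : 4 * `|x| * q ^+ n = 2 * (`|x| * q ^+ n) + `|x| * q ^+ n + `|x| * q ^+ n.
  by ring.
have qx (y : H) : q * `|y| <= `|y| by rewrite ler_piMl //; case/andP: q01 => _ /ltW.
rewrite (le_trans (ler_normB _ _)) // lerD //.
  rewrite (le_trans (ler_normB _ _)) // lerD //.
    rewrite normrZ ger0_norm // ler_wpM2l // (le_trans (HZ _ _)) //.
    rewrite exprS ler_wpM2l // ler_piMl ?exprn_ge0 //.
    by case/andP: q01 => _ /ltW.
  by rewrite (le_trans (Zb _)) // (le_trans (qx _)) ?HZ.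
apply: le_trans (HZ _ _) _; rewrite ler_wpM2r ?exprn_ge0 //.
exact: le_trans (Ybound _ _) (qx _).
Qed.

End QuadraticFixpoint.

Section SquareRoot.
Context {R : realType} (H : hilbertType R) (T : 'B(H, H)).
Hypothesis Tsa : is_adjoint T T.
Hypothesis T1 : forall x, `|x| ^+ 2 <= inner (T x) x.

(** Rescale: with [s] small, [E = 1 - s T] has norm less than [1], because
    [|E x|^2 = |x|^2 - 2 s <T x, x> + s^2 |T x|^2] and [T >= 1]; if [Z] solves
    [(1 - Z)^2 = 1 - E = s T], then [s^(-1/2) (1 - Z)] is a square root of [T].
    It is bounded below since [Z] has norm less than [1], and it is self-adjoint
    and commutes with the commutant of [T] because the iterates do. *)
Lemma sqrt_exists : exists Q : 'B(H, H),
  [/\ is_adjoint Q Q,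
      exists2 c : R[i], 0 < c & forall x, c * `|x| ^+ 2 <= inner (Q x) x,
      (Q \o Q) = T &
      forall D : 'B(H, H), D \o T = T \o D -> D \o Q = Q \o D].
Proof.
have [M M0 HM] := bop_bound T.
(* The square root of the scaling factor [s] must be at hand: hence
   [s = m ^- 2], with [m >= 1] a bound for [T]. *)
pose m := M + 1.
have m1 : 1 <= m by rewrite lerDr.
have m0 : 0 < m by apply: lt_le_trans m1.
have mn0 : m != 0 by rewrite gt_eqF.
pose s : R[i] := m ^- 2.
have s0 : 0 < s by rewrite invr_gt0 exprn_gt0.
have s1 : s <= 1 by rewrite invf_le1 ?exprn_gt0 // exprn_ege1.
have sr : Num.conj s = s by rewrite conj_Creal // gtr0_real.
pose E : 'B(H, H) := \1 - s *: T.
have EE x : E x = x - s *: T x by [].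
clearbody E.
(* [1 - s] bounds the square of the norm of [E], and its root is at most
   [1 - s / 2]. *)
pose q := 1 - s / 2.
have q01 : 0 <= q < 1.
  rewrite subr_ge0 ltrBlDr ltrDl divr_gt0 // andbT ler_pdivrMr // mul1r.
  by rewrite (le_trans s1) // ler1n.
have q0 : 0 <= q by case/andP: q01.
have Tr x : Num.conj (inner (T x) x) = inner (T x) x by rewrite -innerC Tsa.
have Eb x : `|E x| <= q * `|x|.
  rewrite -ler_sqr ?nnegrE ?mulr_ge0 // -inner_norm EE hnormB /=.
  rewrite expr0 mul1r !innerZl !innerZr !inner_norm sr -Tsa.
  rewrite rmorphM /= sr Tr exprMn.
  apply: (@le_trans _ _ ((1 - s) * `|x| ^+ 2)); last first.
    rewrite ler_wpM2r ?exprn_ge0 //.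
    have -> : q ^+ 2 = 1 - s + (s / 2) ^+ 2 by rewrite /q; field.
    by rewrite lerDl exprn_ge0 // divr_ge0 // ltW.
  have h2 : s * (s * `|T x| ^+ 2) <= s * `|x| ^+ 2.
    rewrite ler_pM2l // /s mulrC ler_pdivrMr ?exprn_gt0 // -exprMn mulrC.
    rewrite ler_sqr ?nnegrE ?mulr_ge0 ?(ltW m0) // (le_trans (HM _)) //.
    by rewrite ler_wpM2r // lerDl.
  have h1 : s * `|x| ^+ 2 <= s * inner (T x) x by rewrite ler_pM2l.
  have -> : (1 - s) * `|x| ^+ 2 = `|x| ^+ 2 + s * `|x| ^+ 2 - (s * `|x| ^+ 2 + s * `|x| ^+ 2).
    by ring.
  by rewrite lerB ?lerD.
have [Z [Zb Zfix HZ]] := quadratic_fixpoint q01 Eb.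
have Zsa : is_adjoint Z Z.
  apply: (limit_self_adjoint q01 HZ) => n.
  elim: n => [|n IH] x y; first by rewrite [LHS]linear0l [RHS]linear0r.
  rewrite !quadratic_iterS innerZl innerZr !innerDl !innerDr !IH.
  rewrite conj_Creal ?ger0_real ?invr_ge0 //.
  by rewrite !EE innerBl innerBr innerZl innerZr sr Tsa.
pose Q : 'B(H, H) := m *: (\1 - Z).
have QE x : Q x = m *: (x - Z x) by [].
clearbody Q.
exists Q; split.
- move=> x y; rewrite !QE innerZl innerZr innerBl innerBr Zsa.
  by rewrite conj_Creal // gtr0_real.
- exists (m * (1 - q)).
    by rewrite mulr_gt0 // subr_gt0; case/andP: q01.
  move=> x; rewrite QE innerZl -mulrA ler_pM2l // innerBl /= inner_norm.
  rewrite mulrBl mul1r lerB //.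
  apply: le_trans (_ : `|inner (Z x) x| <= _).
    by rewrite real_ler_norm //; apply/CrealP; rewrite -innerC Zsa.
  rewrite (le_trans (cauchy_schwarz _ _)) // expr2 mulrA.
  by rewrite ler_wpM2r.
- have ZZ x : Z (Z x) = 2 *: Z x - E x by rewrite Zfix addrK.
  apply: bop_ext => x; rewrite /= !QE (linearZ_LR Z) (linearB Z) /= ZZ.
  rewrite EE -!scalerBr !scalerA -expr2.
  have -> : x - Z x - (Z x - (2 *: Z x - (x - s *: T x))) = s *: T x.
    rewrite scaler_nat mulr2n !opprB !addrA.
    by rewrite [LHS](ACl (5*1*6*3*2*4*7)%AC) /= !addrK.
  by rewrite scalerA mulfV ?scale1r // expf_neq0.
- move=> D DT.
  have DE x : D (E x) = E (D x).
    rewrite !EE linearB linearZ /=; congr (_ - s *: _).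
    exact: bop_congr DT.
  apply: bop_ext => x; rewrite /= !QE linearZ linearB /=; congr (_ *: (_ - _)).
  apply: (limit_commute q01 HZ) => n {}x.
  elim: n x => [|n IH] x; first by rewrite [LHS]linear0.
  by rewrite !quadratic_iterS linearZ linearD /= !IH DE.
Qed.

(** Uniqueness: any positive square root [S] of [T] commutes with [T], hence with
    the root [Q] constructed above, so [(Q + S) (Q - S) = 0]; pairing this with
    [y = Q x - S x] gives [<Q y, y> + <S y, y> = 0], and [Q] is bounded below. *)
Lemma sqrt_op_spec :
  [/\ is_adjoint (sqrt_op T) (sqrt_op T),
      sqrt_op T \o sqrt_op T = T &
      forall D : 'B(H, H), D \o T = T \o D ->
        D \o sqrt_op T = sqrt_op T \o D].
Proof.
have [Q [Qsa [c c0 Qc] QQ Qcomm]] := sqrt_exists.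
have [S0 SS] : positive_op (sqrt_op T) /\ (sqrt_op T \o sqrt_op T) = T.
  apply: (@xgetPex _ 0 [set S | positive_op S /\ (S \o S) = T]%classic).
  exists Q; split=> // x; apply: le_trans (Qc x).
  by rewrite mulr_ge0 ?exprn_ge0 // ltW.
suff -> : sqrt_op T = Q by [].
set S := sqrt_op T in S0 SS *.
have ST x : S (S x) = T x by rewrite -[in RHS]SS.
have QT x : Q (Q x) = T x by rewrite -[in RHS]QQ.
have SQ x : S (Q x) = Q (S x).
  have : S \o T = T \o S by rewrite -SS; apply: bop_ext.
  by move/Qcomm/(bop_congr x).
apply: bop_ext => x; apply/esym/eqP; rewrite -subr_eq0; set y := Q x - S x.
have : inner (Q y) y + inner (S y) y = 0.
  rewrite -innerDl /y (linearB S) (linearB Q) /= SQ ST QT addrA subrK subrr.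
  exact: linear0l.
move=> h; have : c * `|y| ^+ 2 <= 0.
  by rewrite -h (le_trans (Qc y)) // lerDl.
by rewrite pmulr_rle0 // -normr_eq0 -[_ == 0]sqrf_eq0 eq_le exprn_ge0 ?andbT.
Qed.

End SquareRoot.

(** * Inverses and Hilbert bases *)

Section Inverse.
Context {R : realType} (H : hilbertType R).

Lemma inv_op_spec (A L S : 'B(H, H)) : L \o A = \1 -> A \o S = \1 ->
  (forall x, inv_op A (A x) = x) /\ (forall x, A (inv_op A x) = x).
Proof.
move=> LA AS.
have LAx x : L (A x) = x by rewrite -[RHS](bop_congr x LA).
have ASx x : A (S x) = x by rewrite -[RHS](bop_congr x AS).
have [i1 i2] : (inv_op A \o A) = \1 /\ (A \o inv_op A) = \1.
  apply: (@xgetPex _ 0 [set S | (S \o A) = \1 /\ (A \o S) = \1]%classic).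
  exists L; split => //; apply: bop_ext => x /=.
  by rewrite -{1}[x]ASx LAx ASx.
split=> x.
- by rewrite -[RHS](bop_congr x i1).
- by rewrite -[RHS](bop_congr x i2).
Qed.

End Inverse.

Section HilbertBasis.
Context {R : realType}.
Implicit Types H K : hilbertType R.

Definition orthonormal_set H (E : set H) :=
  forall x y, E x -> E y -> inner x y = (x == y)%:R.

(** A maximal orthonormal set is a basis: a nonzero vector orthogonal to it could
    be normalised and added. *)
Lemma hilbert_basis_exists H : exists E : set H, hilbert_basis E.
Proof.
have [F FP Ftot|E [Eo Emax]] := @Zorn_bigcup H (@orthonormal_set H).
  move=> x y [X FX Xx] [Y FY Yy].
  have [XY|YX] := Ftot _ _ FX FY.
  - exact: FP _ FY _ _ (XY _ Xx) Yy.
  - exact: FP _ FX _ _ Xx (YX _ Yy).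
exists E; split=> // x xE; apply/eqP/negPn/negP => x0.
have nx0 : `|x| != 0 by rewrite normr_eq0.
pose e := `|x|^-1 *: x.
have eE y : E y -> inner e y = 0 by move=> Ey; rewrite innerZl xE ?mulr0.
have ee : inner e e = 1.
  rewrite innerZl innerZr inner_norm conj_Creal ?ger0_real ?invr_ge0 //.
  by rewrite expr2 (mulKf nx0) mulVf.
have nEe : ~ E e by move=> /eE/eqP; rewrite ee oner_eq0.
have ney y : E y -> (e == y) = false.
  by move=> Ey; apply/negP => /eqP ey; apply: nEe; rewrite ey.
apply: (Emax (E `|` [set e])%classic).
  split; last by move=> h; apply: nEe; apply: h; right.
  by move=> y Ey; left.
move=> u v [Eu|->] [Ev|->].
- exact: Eo.
- by rewrite innerC eE // rmorph0 eq_sym ney.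
- by rewrite eE // ney.
- by rewrite ee eqxx.
Qed.

Lemma unitary_same_hdim H K (U : 'B(K, H)) : unitary_op U -> same_hdim H K.
Proof.
move=> [UU' UU].
have U'K y : U^* (U y) = y by rewrite -[RHS](bop_congr y UU').
have UK x : U (U^* x) = x by rewrite -[RHS](bop_congr x UU).
have Ui : injective U by exact: can_inj U'K.
have [E [Eo Etot]] := hilbert_basis_exists K.
exists (U @` E)%classic, E; split=> //; last by apply: inj_card_eq => x y _ _ /Ui.
split=> [_ _ [x Ex <-] [y Ey <-]|x xE].
  by rewrite adjP U'K (inj_eq Ui) Eo.
rewrite -[x]UK; suff -> : U^* x = 0 by rewrite linear0.
apply: Etot => e Ee; rewrite adjP'; apply: xE; by exists e.
Qed.

End HilbertBasis.

(** * Orthogonal decomposition along a closed subspace *)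

Section Inclusion.
Context {R : realType} (H : hilbertType R) (V : csubspace H).

Lemma incl_subproof : (fun x : V => val x) \in @bounded_linear R[i] V H.
Proof. by apply: bounded_linearP => //; exists 1 => x; rewrite mul1r. Qed.

Definition incl : 'B(V, H) := Bop incl_subproof.

(** With [incl^*] the orthogonal projection onto [V], this says that the
    projection fixes [V]. *)
Lemma incl_adjK x : incl^* (incl x) = x.
Proof. by apply: inner_inj => z; rewrite -adjP. Qed.

End Inclusion.

Section Decomposition.
Context {R : realType} (H : hilbertType R) (V : csubspace H).
Let i := incl V.
Let j := incl (orthoc V).

Lemma inner_orthoc (x : V) (y : orthoc V) : inner (i x) (j y) = 0.
Proof.
rewrite innerC; have /set_mem h := csub_subproof y.
by rewrite /i /j /= (h (val x)) ?rmorph0 //; exact: set_mem (csub_subproof x).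
Qed.

Lemma adj_incl_orthoc y : i^* (j y) = 0.
Proof. by apply: inner_inj => z; rewrite -adjP inner_orthoc linear0r. Qed.

Lemma adj_orthoc_incl x : j^* (i x) = 0.
Proof.
by apply: inner_inj => z; rewrite -adjP linear0r innerC inner_orthoc rmorph0.
Qed.

(** The vector [h - i (i^* h)] is orthogonal to [V], and is then necessarily the
    component of [h] along the complement. *)
Lemma orthoc_decomposition h : h = i (i^* h) + j (j^* h).
Proof.
have Wh : csub_set (orthoc V) (h - i (i^* h)).
  move=> y Vy; pose v : V := CSub (mem_set Vy).
  rewrite -[y]/(i v) innerBl -!adjP' incl_adjK subrr //.
pose w : orthoc V := CSub (mem_set Wh).
have hE : h = i (i^* h) + j w by rewrite addrC subrK.
suff -> : j^* h = w by [].
by rewrite [in LHS]hE bopD adj_orthoc_incl add0r incl_adjK.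
Qed.

End Decomposition.

(** * The blocks of the symmetry *)

Section UnitaryFactor.
Context {R : realType} (V W : hilbertType R).
(** The operators [A], [B], [B^*], [D] are to be the blocks of the symmetry.  The
    first group of relations comes from [J P + P J = J], the second one from
    [J^2 = 1]. *)
Variables (A : 'B(V, V)) (B : 'B(W, V)) (D : 'B(W, W)) (P1 : 'B(W, V)).
Local Notation C := (B^*).
Hypotheses (Asa : is_adjoint A A) (Dsa : is_adjoint D D).
Hypotheses (AE : forall x, A x = - P1 (C x)) (CP1 : forall y, C (P1 y) = D y)
  (AP1 : forall y, A (P1 y) = - P1 (D y)).
Hypotheses (AABC : forall x, A (A x) + B (C x) = x)
  (ABBD : forall y, A (B y) + B (D y) = 0)
  (CADC : forall x, C (A x) + D (C x) = 0)
  (CBDD : forall y, C (B y) + D (D y) = y).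

Let BP x : B (P1^* x) = - A x.
Proof.
apply: inner_inj => z; rewrite -[in LHS]adjP' -adjP.
by rewrite innerNr /= -Asa AE innerNl opprK.
Qed.

Let PB y : P1^* (B y) = D y.
Proof. by apply: inner_inj => z; rewrite -adjP -adjP' CP1 Dsa. Qed.

Let PA x : P1^* (A x) = - D (P1^* x).
Proof.
apply: inner_inj => z; rewrite -adjP -Asa AP1.
by rewrite innerNl adjP Dsa innerNr.
Qed.

Let T : 'B(W, W) := \1 + (P1^* \o P1).

Let TE y : T y = y + P1^*%B (P1 y).
Proof. by []. Qed.

Let Tsa : is_adjoint T T.
Proof. by move=> x y; rewrite !TE innerDl innerDr adjP' adjP. Qed.

Let T1 x : `|x| ^+ 2 <= inner (T x) x.
Proof. by rewrite TE innerDl inner_norm adjP' inner_norm lerDl exprn_ge0. Qed.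

(** These three identities are entries of [J^2 = 1] in which [A] and [D] have been
    expressed through [B] and [P1]; they say that [B] is invertible and that
    [T] is the inverse of [B^* B]. *)
Let BTC x : B (T (C x)) = x.
Proof.
rewrite TE bopD BP -[RHS]AABC addrC; congr (_ + _).
by rewrite -bopN -AE.
Qed.

Let TCB y : T (C (B y)) = y.
Proof.
rewrite TE -[RHS]CBDD; congr (_ + _).
have -> : P1 (C (B y)) = - A (B y) by rewrite AE opprK.
rewrite -PB; congr (P1^* _).
by apply/esym/eqP; rewrite -addr_eq0 addrC ABBD.
Qed.

Let CBT y : C (B (T y)) = y.
Proof.
rewrite TE bopD BP bopD bopN -[RHS]CBDD; congr (_ + _).
rewrite -(CP1 y); apply/esym/eqP.
by rewrite -addr_eq0 addrC CADC.
Qed.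

(** [P1^* P1 D = - P1^* A P1 = D P1^* P1]. *)
Let DT : D \o T = T \o D.
Proof.
apply: bop_ext => y; rewrite -[LHS]/(D (T y)) -[RHS]/(T (D y)) !TE bopD; congr (_ + _).
by rewrite -[RHS]opprK -bopN -AP1 PA opprK.
Qed.

(** The polar decomposition of [B]: as [T = (B^* B)^(-1)], the modulus of [B] is
    the inverse of the square root of [T]. *)
Let Q := sqrt_op T.
Let S := inv_op Q.
Let U := B \o Q.

Let Qadj : Q^* = Q.
Proof. by apply: adjoint_unique; case: (sqrt_op_spec Tsa T1). Qed.

Let QQ y : Q (Q y) = T y.
Proof. by case: (sqrt_op_spec Tsa T1) => _ QQ _; rewrite -QQ. Qed.

Let DQ y : D (Q y) = Q (D y).
Proof.
case: (sqrt_op_spec Tsa T1) => _ _ /(_ D DT) h.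
exact: bop_congr h.
Qed.

(** [Q B^* B] and [B^* B Q] are one-sided inverses of [Q] because [Q^2 = T]. *)
Let SQ : (forall y, S (Q y) = y) /\ (forall y, Q (S y) = y).
Proof.
apply: (@inv_op_spec _ _ Q (C \o B \o Q) (Q \o C \o B)); apply: bop_ext => y.
- by rewrite !bcompE QQ CBT.
- by rewrite !bcompE QQ TCB.
Qed.

Let CBQ y : C (B (Q y)) = S y.
Proof. by rewrite -{1}(SQ.2 y) QQ CBT. Qed.

Let Uadj : U^* = Q \o C.
Proof. by rewrite /U adjM Qadj. Qed.

Lemma unitary_factor : exists U : 'B(W, V),
  [/\ unitary_op U, U^* \o P1 = P1^* \o U &
      let S := inv_sqrt_op (\1 + (P1^* \o P1)%B) in
      [/\ A = - (U \o S \o P1^*)%B, B = U \o S,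
          C = S \o U^* & D = P1^* \o U \o S]].
Proof.
exists U; split=> [||S'].
- split; apply: bop_ext => x; rewrite Uadj !bcompE.
  + by rewrite CBQ SQ.2.
  + by rewrite QQ BTC.
(* The two sides are [Q D] and [D Q]. *)
- by apply: bop_ext => y; rewrite bcompE Uadj !bcompE PB CP1 DQ.
have -> : S' = S by [].
have EB : B = U \o S by apply: bop_ext => y; rewrite !bcompE SQ.2.
split=> //; apply: bop_ext => x.
- by rewrite -EB -[RHS]/(- B (P1^* x)) BP opprK.
- by rewrite Uadj !bcompE SQ.1.
- by rewrite -PB {1}EB.
Qed.

End UnitaryFactor.

Section SymmetryBlocks.
Context {R : realType} (H : hilbertType R) (P J : 'B(H, H)) (V : csubspace H)
  (P1 : 'B(orthoc V, V)).
Hypotheses (blockP : block_form P \1 P1 0 0)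
  (symJ : symmetry J) (JPJ : J \o P \o J = \1 - P).

Let i := incl V.
Let j := incl (orthoc V).

Let A := i^* \o J \o i.
Let B := i^* \o J \o j.
Let C := B^*.
Let D := j^* \o J \o j.

Let ADE : (forall x, A x = i^* (J (i x))) * (forall y, D y = j^* (J (j y))).
Proof. by []. Qed.

Let JJ h : J (J h) = h.
Proof. by rewrite -[RHS](bop_congr h symJ.2). Qed.

Let Jsa x y : inner (J x) y = inner x (J y).
Proof. by rewrite adjP symJ.1. Qed.

Let CE x : C x = j^* (J (i x)).
Proof.
have BE y : B y = i^* (J (j y)) by [].
by apply: inner_inj => y; rewrite -[LHS]adjP -[RHS]adjP BE adjP' Jsa.
Qed.

Let Ji x : J (i x) = i (A x) + j (C x).
Proof. rewrite CE; exact: orthoc_decomposition. Qed.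

Let Jj y : J (j y) = i (B y) + j (D y).
Proof. exact: orthoc_decomposition. Qed.

Let Pi x : P (i x) = i x.
Proof.
have : P (i x + j 0) = i (x + P1 0) + j (0 + 0) := blockP x 0.
by rewrite addr0 !bop0 !addr0.
Qed.

Let Pj y : P (j y) = i (P1 y).
Proof.
have : P (i 0 + j y) = i (0 + P1 y) + j (0 + 0) := blockP 0 y.
by rewrite !add0r !bop0 ?add0r addr0.
Qed.

(** The hypothesis in linear form, obtained by evaluating it at [J h]. *)
Let JP h : J (P h) + P (J h) = J h.
Proof.
have := bop_congr (J h) JPJ.
by rewrite /= JJ => ->; rewrite subrK.
Qed.

Let split_eq x y x' y' : i x + j y = i x' + j y' -> x = x' /\ y = y'.
Proof.
move=> e; have ei := congr1 i^* e; have ej := congr1 j^* e.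
move: ei ej; rewrite !bopD !incl_adjK !adj_incl_orthoc !adj_orthoc_incl.
by rewrite !addr0 !add0r.
Qed.

Let AE x : A x = - P1 (C x).
Proof.
have := JP (i x); rewrite Pi -[RHS]addr0 => /addrI; rewrite Ji bopD Pi Pj -bopD => e.
have /split_eq[] : i (A x + P1 (C x)) + j 0 = i 0 + j 0.
  by rewrite e !bop0 addr0.
by move=> /eqP; rewrite addr_eq0 => /eqP.
Qed.

Let D_eq y : A (P1 y) = - P1 (D y) /\ C (P1 y) = D y.
Proof.
have := JP (j y); rewrite Pj Ji Jj bopD Pi Pj => e.
have /split_eq[] : i (A (P1 y) + (B y + P1 (D y))) + j (C (P1 y)) = i (B y) + j (D y).
  by rewrite -e !bopD addrAC.
move=> e1 e2; split=> //; apply/eqP; rewrite -addr_eq0; apply/eqP.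
by apply: (addrI (B y)); rewrite addr0 addrCA.
Qed.

Let JJi x : A (A x) + B (C x) = x /\ C (A x) + D (C x) = 0.
Proof.
have /split_eq[] // : i (A (A x) + B (C x)) + j (C (A x) + D (C x)) = i x + j 0.
by rewrite bop0 addr0 -[RHS]JJ Ji bopD Ji Jj !bopD addrACA.
Qed.

Let JJj y : A (B y) + B (D y) = 0 /\ C (B y) + D (D y) = y.
Proof.
have /split_eq[] // : i (A (B y) + B (D y)) + j (C (B y) + D (D y)) = i 0 + j y.
by rewrite bop0 add0r -[RHS]JJ Jj bopD Ji Jj !bopD addrACA.
Qed.

Let Asa x y : inner (A x) y = inner x (A y).
Proof. by rewrite !ADE adjP' Jsa adjP. Qed.

Let Dsa x y : inner (D x) y = inner x (D y).
Proof. by rewrite !ADE adjP' Jsa adjP. Qed.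

Lemma symmetry_block_form : exists U : 'B(orthoc V, V),
  [/\ unitary_op U, U^* \o P1 = P1^* \o U &
      let S := inv_sqrt_op (\1 + (P1^* \o P1)%B) in
      block_form J
        (- (U \o S \o P1^*)%B) (U \o S)
        (S \o U^*)           (P1^* \o U \o S)].
Proof.
have [U [Uu UP [EA EB EC ED]]] := unitary_factor Asa Dsa AE
  (fun y => (D_eq y).2) (fun y => (D_eq y).1) (fun x => (JJi x).1)
  (fun y => (JJj y).1) (fun x => (JJi x).2) (fun y => (JJj y).2).
exists U; split=> // S x y; rewrite -EA -EB -EC -ED.
rewrite -[val x]/(i x) -[val y]/(j y) bopD Ji Jj addrACA -!bopD.
by [].
Qed.

End SymmetryBlocks.

Theorem theorem2p7 (R : realType) (H : hilbertType R) (sepH : separable H)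
    (P : 'B(H, H)) (idemP : P \o P = P)
    (V := idem_range idemP)
    (P1 : 'B(orthoc V, V)) (blockP : block_form P \1 P1 0 0)
    (J : 'B(H, H)) (symJ : symmetry J) (JPJ : J \o P \o J = \1 - P) :
  same_hdim V (orthoc V) /\
  exists U : 'B(orthoc V, V),
    [/\ unitary_op U,
        U^* \o P1 = P1^* \o U &
        let S := inv_sqrt_op (\1 + (P1^* \o P1)%B) in
        block_form J
          (- (U \o S \o P1^*)%B) (U \o S)
          (S \o U^*)           (P1^* \o U \o S)].
Proof.
have [U [Uu UP1 JE]] := symmetry_block_form blockP symJ JPJ.
by split; [exact: unitary_same_hdim Uu | exists U].
Qed.
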